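(* Let $(p_0,\mathsf{u}_0)$ and $(p_1,\mathsf{u}_1)$ be a calibrated pair and suppose that $\mathcal{C}(p_0,\mathsf{u}_0)$ and $\mathcal{C}(p_1,\mathsf{u}_1)$ are disjoint crooked planes. Then there exists a crooked foliation containing them (i.e. having both crooked planes among its members).
   Context: $\mathsf{V}=\mathbb{R}^3$ with scalar product $\mathsf{x}\cdot\mathsf{y}=x_1y_1+x_2y_2-x_3y_3$; $\mathsf{E}$ is the affine space modeled on $\mathsf{V}$. A nonzero vector $\mathsf{v}$ is timelike, null, or spacelike if $\mathsf{v}\cdot\mathsf{v}$ is $<0$, $=0$, $>0$; unit-spacelike if $\mathsf{v}\cdot\mathsf{v}=1$. $\mathsf{v}^\perp$ is the orthogonal of $\mathsf{v}$ for this product. For $\mathsf{u}$ spacelike, $\mathsf{u}^-,\mathsf{u}^+$ are the null vectors with third coordinate $1$ such that $\mathsf{u}^\perp=\langle \mathsf{u}^-,\mathsf{u}^+\rangle$ and $\det[\mathsf{u}\ \mathsf{u}^-\ \mathsf{u}^+]>0$. The crooked plane $\mathcal{C}(p,\mathsf{u})$ with vertex $p\in\mathsf{E}$ and (spacelike) director $\mathsf{u}$ is the union of the stem $p+\{\mathsf{x}\in\mathsf{u}^\perp:\mathsf{x}\cdot\mathsf{x}\le 0\}$ and the two wings $p+\{\mathsf{x}\in(\mathsf{u}^+)^\perp \text{ spacelike}:\mathsf{x}^+=\mathsf{u}^+\}$ and $p+\{\mathsf{x}\in(\mathsf{u}^-)^\perp\text{ spacelike}:\mathsf{x}^+=\mathsf{u}^-\}$.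 Note $\mathcal{C}(p,\mathsf{u})=\mathcal{C}(p,-\mathsf{u})$. A crooked foliation is a family $\{\mathcal{C}(p_t,\mathsf{u}_t)\}_{t\in\mathbb{R}}$ of pairwise disjoint crooked planes, where $(\mathsf{u}_t)$ is a continuous curve of spacelike vectors and $(p_t)$ is a regular curve (smooth, nowhere zero tangent) in $\mathsf{E}$. Two spacelike vectors are ultraparallel if the line $\mathsf{u}_1^\perp\cap\mathsf{u}_2^\perp$ is spacelike. An ultraparallel pair $\mathsf{u}_1,\mathsf{u}_2$ is consistently oriented if $\mathsf{u}_1\cdot\mathsf{u}_2<0$ and $\mathsf{u}_i\cdot\mathsf{u}_j^{\pm}\le 0$ for $i,j=1,2$. Calibrated pair: let $\mathsf{u}_0,\mathsf{u}_1$ be ultraparallel unit-spacelike vectors, with signs chosen so that $-\mathsf{u}_0,\mathsf{u}_1$ are consistently oriented, and let $p_0,p_1\in\mathsf{E}$. Then, after a change of coordinates by a linear isometry of determinant $1$, there is a unique $l>0$ with $\mathsf{u}_0=(1,0,0)$ and $\mathsf{u}_1=(\cosh l,0,\sinh l)$; these lie on the curve $\mathsf{u}_t=(\cosh lt,0,\sinh lt)$. Suppose moreover that, after a translation of the origin, $p_0$ and $p_1$ are the points at $t=0$ and $t=1$ of a curve $$p_t=\bigl(k\cosh(l(t+t_0)),\ \alpha t,\ k\sinh(l(t+t_0))\bigr)$$ for some $k\ne0$, $t_0\in\mathbb{R}$, $\alpha>0$, with the same $l$. Then $(p_0,\mathsf{u}_0)$ and $(p_1,\mathsf{u}_1)$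 are called a calibrated pair if and only if $t_0=0$. *)

(* Defs.v *)
From Stdlib Require Import Reals Lra Psatz ClassicalEpsilon.
From Coquelicot Require Import Coquelicot.
Open Scope R_scope.

(* The vector operations and the topology of V are Coquelicot's product ones. *)
Definition V : Type := (R * R * R)%type.

(* E is identified with V by a choice of origin; differences of points are
   vectors, and translations are the maps [fun p => plus p c]. *)
Definition E : Type := V.

Definition vec (x y z : R) : V := (x, y, z).
Definition c1 (v : V) : R := fst (fst v).
Definition c2 (v : V) : R := snd (fst v).
Definition c3 (v : V) : R := snd v.

Definition dot (x y : V) : R := c1 x * c1 y + c2 x * c2 y - c3 x * c3 y.

Definition det3 (u v w : V) : R :=
  c1 u * (c2 v * c3 w - c3 v * c2 w)
  - c2 u * (c1 v * c3 w - c3 v * c1 w)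
  + c3 u * (c1 v * c2 w - c2 v * c1 w).

Definition null (v : V) : Prop := v <> zero /\ dot v v = 0.
Definition spacelike (v : V) : Prop := v <> zero /\ 0 < dot v v.
Definition unit_spacelike (v : V) : Prop := dot v v = 1.

(* [null_frame u m p] says that u^- = m and u^+ = p. *)
Definition null_frame (u m p : V) : Prop :=
  null m /\ null p /\ c3 m = 1 /\ c3 p = 1 /\
  (forall x : V, dot x u = 0 <->
     exists a b : R, x = plus (scal a m) (scal b p)) /\
  0 < det3 u m p.

(* The pair (u^-, u^+); it is meaningful for spacelike u only, where
   existence and uniqueness are [null_pairP] and [null_frame_unique]. *)
Definition null_pair (u : V) : V * V :=
  epsilon (inhabits (zero, zero)) (fun q : V * V => null_frame u (fst q) (snd q)).
Definition uminus (u : V) : V := fst (null_pair u).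
Definition uplus (u : V) : V := snd (null_pair u).

Lemma V_ext (x y : V) : c1 x = c1 y -> c2 x = c2 y -> c3 x = c3 y -> x = y.
Proof.
  destruct x as [[a b] c], y as [[a' b'] c']; unfold c1, c2, c3; simpl.
  congruence.
Qed.

Lemma null_frame_unique (u m p m' p' : V) :
  null_frame u m p -> null_frame u m' p' -> m' = m /\ p' = p.
Proof.
  destruct u as [[u1 u2] u3], m as [[m1 m2] m3], p as [[p1 p2] p3],
    m' as [[m1' m2'] m3'], p' as [[p1' p2'] p3'].
  intros [[_ Nm] [[_ Np] [Em [Ep [S D]]]]] [[_ Nm'] [[_ Np'] [Em' [Ep' [S' D']]]]].
  assert (H1 : dot (m1', m2', m3') (u1, u2, u3) = 0).
  { apply S'. exists 1, 0. apply V_ext; cbn; ring. }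
  assert (H2 : dot (p1', p2', p3') (u1, u2, u3) = 0).
  { apply S'. exists 0, 1. apply V_ext; cbn; ring. }
  apply S in H1; apply S in H2.
  destruct H1 as [a [b H1]], H2 as [c [d H2]].
  cbn in H1, H2; injection H1 as -> -> ->; injection H2 as -> -> ->.
  clear S S'.
  unfold dot, det3, c1, c2, c3 in *; cbn in *; subst m3 p3.
  unfold mult in *; cbn in *.
  assert (Hb : b = 1 - a) by lra. assert (Hd : d = 1 - c) by lra. subst b d.
  assert (Q : m1 * p1 + m2 * p2 - 1 <> 0).
  { intro Q. assert (Z : (m1 - p1) * (m1 - p1) + (m2 - p2) * (m2 - p2) = 0) by lra.
    apply Rplus_sqr_eq_0 in Z; destruct Z as [Z1 Z2].
    assert (m1 = p1) by lra. assert (m2 = p2) by lra. subst. nra. }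
  assert (Qa : a * (1 - a) * (m1 * p1 + m2 * p2 - 1) = 0).
  { assert (a * a * (m1 * m1 + m2 * m2 - 1 * 1) = 0) by (rewrite Nm; ring).
    assert ((1 - a) * (1 - a) * (p1 * p1 + p2 * p2 - 1 * 1) = 0)
      by (rewrite Np; ring).
    lra. }
  assert (Qc : c * (1 - c) * (m1 * p1 + m2 * p2 - 1) = 0).
  { assert (c * c * (m1 * m1 + m2 * m2 - 1 * 1) = 0) by (rewrite Nm; ring).
    assert ((1 - c) * (1 - c) * (p1 * p1 + p2 * p2 - 1 * 1) = 0)
      by (rewrite Np; ring).
    lra. }
  assert (Ha : a = 0 \/ a = 1).
  { apply Rmult_integral in Qa; destruct Qa as [Qa | Qa]; [|easy].
    apply Rmult_integral in Qa; lra. }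
  assert (Hc : c = 0 \/ c = 1).
  { apply Rmult_integral in Qc; destruct Qc as [Qc | Qc]; [|easy].
    apply Rmult_integral in Qc; lra. }
  destruct Ha, Hc; subst a c; try (exfalso; lra).
  split; apply V_ext; cbn; ring.
Qed.

Lemma null_frame_exists (u : V) :
  spacelike u -> exists m p : V, null_frame u m p.
Proof.
  destruct u as [[a b] c]; intros [_ H]; unfold dot, c1, c2, c3 in H; cbn in H.
  set (n := a * a + b * b - c * c) in H.
  set (r := sqrt n).
  assert (Hr : r * r = n) by (apply sqrt_sqrt; lra).
  assert (Hr0 : 0 < r) by (apply sqrt_lt_R0; exact H).
  unfold n in *.
  set (s := a * a + b * b).
  assert (Hs : 0 < s) by (unfold s; nra).
  assert (Hrs : r * r = s - c * c) by (unfold s; lra).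
  set (m := vec ((a * c - b * r) / s) ((b * c + a * r) / s) 1).
  set (p := vec ((a * c + b * r) / s) ((b * c - a * r) / s) 1).
  assert (N1 : forall e, e * e = 1 ->
     ((a * c - e * (b * r)) / s) * ((a * c - e * (b * r)) / s)
     + ((b * c + e * (a * r)) / s) * ((b * c + e * (a * r)) / s) = 1).
  { intros e He.
    replace (_ + _) with (s * (c * c + (e * e) * (r * r)) / (s * s))
      by (unfold s in *; field; lra).
    rewrite He, Hrs. field. lra. }
  exists m, p.
  assert (Z : forall x y, vec x y 1 <> zero).
  { intros x y Q. apply (f_equal c3) in Q. cbn in Q. lra. }
  repeat split; try apply Z.
  - unfold dot, m, vec, c1, c2, c3; cbn.
    generalize (N1 1 ltac:(ring)). rewrite !Rmult_1_l. lra.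
  - unfold dot, p, vec, c1, c2, c3; cbn. generalize (N1 (-1) ltac:(ring)).
    replace (a * c - -1 * (b * r)) with (a * c + b * r) by ring.
    replace (b * c + -1 * (a * r)) with (b * c - a * r) by ring. lra.
  - destruct x as [[x y] z]. unfold dot, c1, c2, c3; cbn. intro Q.
    assert (Q' : x * a + y * b = z * c) by lra.
    exists ((z + (a * y - b * x) / r) / 2), ((z - (a * y - b * x) / r) / 2).
    apply V_ext; cbn; unfold mult; cbn.
    + transitivity ((c * z * a - b * (a * y - b * x)) / s); [|field; lra].
      replace (c * z) with (x * a + y * b) by lra. unfold s in *; field; lra.
    + transitivity ((c * z * b + a * (a * y - b * x)) / s); [|field; lra].
      replace (c * z) with (x * a + y * b) by lra. unfold s in *; field; lra.
    + field. lra.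
  - intros [y [z ->]]. unfold dot, m, p, vec, c1, c2, c3; cbn; unfold mult; cbn.
    unfold s in *; field; lra.
  - unfold det3, m, p, vec, c1, c2, c3; cbn.
    replace (_ + _) with (2 * r * (s - c * c) / s).
    2: { unfold s in *; field; lra. }
    rewrite <- Hrs. apply Rdiv_lt_0_compat; nra.
Qed.

Lemma null_pairP (u : V) : spacelike u -> null_frame u (uminus u) (uplus u).
Proof.
  intro H. destruct (null_frame_exists u H) as [m [p F]].
  unfold uminus, uplus, null_pair.
  apply (epsilon_spec (inhabits (zero, zero))
           (fun q : V * V => null_frame u (fst q) (snd q))).
  now exists (m, p).
Qed.

Definition stem (u x : V) : Prop := dot x u = 0 /\ dot x x <= 0.
Definition wing_plus (u x : V) : Prop :=
  spacelike x /\ dot x (uplus u) = 0 /\ uplus x = uplus u.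
Definition wing_minus (u x : V) : Prop :=
  spacelike x /\ dot x (uminus u) = 0 /\ uplus x = uminus u.

Definition crooked_plane (p : E) (u : V) (q : E) : Prop :=
  let x : V := minus q p in stem u x \/ wing_plus u x \/ wing_minus u x.

Definition disjoint (A B : E -> Prop) : Prop := forall q : E, ~ (A q /\ B q).
Definition same_set (A B : E -> Prop) : Prop := forall q : E, A q <-> B q.

Definition smooth (f : R -> R) : Prop := forall (n : nat) (t : R), ex_derive_n f n t.

Definition regular_curve (p : R -> E) : Prop :=
  smooth (fun t => c1 (p t)) /\ smooth (fun t => c2 (p t)) /\
  smooth (fun t => c3 (p t)) /\
  forall t : R,
    vec (Derive (fun s => c1 (p s)) t) (Derive (fun s => c2 (p s)) t)
        (Derive (fun s => c3 (p s)) t) <> zero.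

Definition crooked_foliation (p : R -> E) (u : R -> V) : Prop :=
  (forall t : R, spacelike (u t)) /\
  (forall t : R, continuous u t) /\
  regular_curve p /\
  (forall s t : R, s <> t ->
     disjoint (crooked_plane (p s) (u s)) (crooked_plane (p t) (u t))).

Definition ultraparallel (u1 u2 : V) : Prop :=
  spacelike u1 /\ spacelike u2 /\
  exists w : V, spacelike w /\
    forall x : V, (dot x u1 = 0 /\ dot x u2 = 0) <-> exists a : R, x = scal a w.

Definition consistently_oriented (u1 u2 : V) : Prop :=
  ultraparallel u1 u2 /\ dot u1 u2 < 0 /\
  forall v w : V, (v = u1 \/ v = u2) -> (w = u1 \/ w = u2) ->
    dot v (uminus w) <= 0 /\ dot v (uplus w) <= 0.

(* [is_linear] also asks for boundedness, automatic in finite dimension. *)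
Definition linear_isometry_det1 (A : V -> V) : Prop :=
  is_linear A /\
  (forall x y : V, dot (A x) (A y) = dot x y) /\
  det3 (A (vec 1 0 0)) (A (vec 0 1 0)) (A (vec 0 0 1)) = 1.

Definition vertex_curve (l k alpha t0 t : R) : E :=
  vec (k * cosh (l * (t + t0))) (alpha * t) (k * sinh (l * (t + t0))).

(* In the coordinates given by the linear isometry A followed by the
   translation by c, the two pairs have the normal form with parameter t0.
   The data A, l, c, k, alpha, t0 are determined by the pairs. *)
Definition normal_form (p0 : E) (u0 : V) (p1 : E) (u1 : V) (t0 : R) : Prop :=
  exists (A : V -> V) (c : V) (l k alpha : R),
    linear_isometry_det1 A /\
    0 < l /\ k <> 0 /\ 0 < alpha /\
    A u0 = vec 1 0 0 /\ A u1 = vec (cosh l) 0 (sinh l) /\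
    plus (A p0) c = vertex_curve l k alpha t0 0 /\
    plus (A p1) c = vertex_curve l k alpha t0 1.

Definition calibrated_pair (p0 : E) (u0 : V) (p1 : E) (u1 : V) : Prop :=
  unit_spacelike u0 /\ unit_spacelike u1 /\
  ultraparallel u0 u1 /\ consistently_oriented (opp u0) u1 /\
  normal_form p0 u0 p1 u1 0.

(* Main.v *)
Require Import Defs.
From Stdlib Require Import Reals Lra Psatz.
From Coquelicot Require Import Coquelicot.
Import Defs. (* Reals shadows c1 *)
Open Scope R_scope.

(** In the normal form with t0 = 0 and lam = l / 2, the vertices differ by the
    sum of (0, alpha/2, k tanh lam) and its boost by l.  If
    alpha/2 <= |k| tanh lam, both summands lie in the stems, which then meet;
    hence disjointness gives alpha/2 > |k| tanh lam.  The curve of the normal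
    form itself may fail to give a foliation: that would need alpha >= |k| l,
    while only alpha > 2 |k| tanh lam is available.  After a boost making the
    picture symmetric, it is replaced by the hyperbola-like curve
      p_s = (c d cosh s + x0, a sinh s + |d| s, d sinh s),
      u_s proportional to (cosh s, 0, c sinh s),
    through the two given planes at s = - sigma and s = sigma.  For large sigma
    it follows closely the broken line with directions orthogonal to u_0 and
    u_1, so the inequality above is exactly what makes its tangent lie in the
    stem quadrants; the chords then satisfy the Drumm-Goldman disjointness
    criterion. *)

(** * Null frames and the side of the director on which each wing lies *)

Ltac coords := unfold dot, det3, vec, c1, c2, c3 in *; cbn in *; unfold mult in *; cbn in *.

Lemma dot_sym (x y : V) : dot x y = dot y x.
Proof. unfold dot; ring. Qed.

Lemma dot_minus_l (x y z : V) : dot (minus x y) z = dot x z - dot y z.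
Proof. coords; unfold minus, plus, opp; cbn; ring. Qed.

Lemma dot_scal_l (a : R) (x y : V) : dot (scal a x) y = a * dot x y.
Proof. coords; ring. Qed.

Lemma null_frame_perp (u m p : V) :
  null_frame u m p -> dot m u = 0 /\ dot p u = 0.
Proof.
  intros [_ [_ [_ [_ [S _]]]]]; split; apply S.
  - exists 1, 0. apply V_ext; coords; ring.
  - exists 0, 1. apply V_ext; coords; ring.
Qed.

Lemma null_frame_opp (u m p : V) : null_frame u m p -> null_frame (opp u) p m.
Proof.
  intros [Nm [Np [Em [Ep [S D]]]]]; repeat (split; [assumption|]). split.
  - intro x. assert (Q : dot x (opp u) = - dot x u) by (coords; ring).
    rewrite Q; split.
    + intro H. destruct (proj1 (S x)) as [a [b E]]; [lra|].
      exists b, a. rewrite E. apply plus_comm.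
    + intros [a [b E]]. rewrite (proj2 (S x)); [ring|].
      exists b, a. rewrite E. apply plus_comm.
  - replace (det3 (opp u) p m) with (det3 u m p); [exact D|]. coords; ring.
Qed.

(* With w = (-p2, p1, 0), p^perp is spanned by p and the unit vector w, so the
   w-coordinate of x is positive exactly when det3 x m p > 0. *)
Lemma null_frame_common_plus (x u m m' p : V) :
  null_frame x m p -> null_frame u m' p -> 0 < dot x u.
Proof.
  assert (K : forall v n q : V, null_frame v n q ->
    exists g h : R, 0 < h /\
      v = plus (scal g q) (scal h (vec (- c2 q) (c1 q) 0))).
  { intros v n q F. destruct (null_frame_perp _ _ _ F) as [_ P].
    destruct F as [[_ Nn] [[_ Nq] [En [Eq [_ D]]]]].
    destruct v as [[v1 v2] v3], n as [[n1 n2] n3], q as [[q1 q2] q3].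
    coords. subst n3 q3.
    exists v3, (q1 * v2 - q2 * v1); split.
    - replace v3 with (q1 * v1 + q2 * v2) in D by lra.
      assert (B : 0 <= 1 - (n1 * q1 + n2 * q2)).
      { pose proof (Rle_0_sqr (n1 - q1)); pose proof (Rle_0_sqr (n2 - q2)).
        unfold Rsqr in *; lra. }
      assert (D' : 0 < (q1 * v2 - q2 * v1) * (1 - (n1 * q1 + n2 * q2))).
      { replace (1 - (n1 * q1 + n2 * q2))
          with (q1 * q1 + q2 * q2 - (n1 * q1 + n2 * q2)) by lra.
        assert (Z1 : v1 * (n2 * (1 * 1) - 1 * q2) = v1 * (n2 * (q1 * q1 + q2 * q2) - q2)).
        { replace (q1 * q1 + q2 * q2) with (1 * 1) by lra. ring. }
        assert (Z2 : v2 * (n1 * (1 * 1) - 1 * q1) = v2 * (n1 * (q1 * q1 + q2 * q2) - q1)).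
        { replace (q1 * q1 + q2 * q2) with (1 * 1) by lra. ring. }
        assert (Z3 : (q1 * v2 - q2 * v1) * (q1 * q1 + q2 * q2) = (q1 * v2 - q2 * v1) * (1 * 1)).
        { replace (q1 * q1 + q2 * q2) with (1 * 1) by lra. ring. }
        lra. }
      nra.
    - assert (Q : q1 * q1 + q2 * q2 = 1) by lra.
      replace v3 with (v1 * q1 + v2 * q2) by lra.
      apply V_ext; cbn; unfold mult; cbn; try ring.
      + replace v1 with (v1 * (q1 * q1 + q2 * q2)) at 1 by (rewrite Q; ring). ring.
      + replace v2 with (v2 * (q1 * q1 + q2 * q2)) at 1 by (rewrite Q; ring). ring. }
  intros Fx Fu.
  destruct (K _ _ _ Fx) as [g [h [Hh ->]]], (K _ _ _ Fu) as [g' [h' [Hh' ->]]].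
  destruct Fu as [_ [[_ Np] [_ [Ep _]]]].
  destruct p as [[q1 q2] q3]; coords. subst q3.
  (* Both decompositions use the same null vector with [q1 * q1 + q2 * q2 = 1], so the product of
     the two vectors reduces to [h * h']. *)
  match goal with |- 0 < ?e => replace e with
    ((g * g' + h * h') * (q1 * q1 + q2 * q2) - g * g' * (1 * 1)) by ring end.
  replace (q1 * q1 + q2 * q2) with (1 * 1) by lra. nra.
Qed.

Lemma wing_plus_side (u x : V) : spacelike u -> wing_plus u x -> 0 < dot x u.
Proof.
  intros Hu [Hx [_ Q]].
  pose proof (null_pairP _ Hx) as F. rewrite Q in F.
  exact (null_frame_common_plus _ _ _ _ _ F (null_pairP _ Hu)).
Qed.

(** Passing to [opp u] exchanges the two null vectors, so the minus wing of [u] is handled as a plus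
    wing of [opp u]. *)
Lemma wing_minus_side (u x : V) : spacelike u -> wing_minus u x -> dot x u < 0.
Proof.
  intros Hu [Hx [_ Q]].
  pose proof (null_pairP _ Hx) as F. rewrite Q in F.
  pose proof (null_frame_common_plus _ _ _ _ _ F
    (null_frame_opp _ _ _ (null_pairP _ Hu))) as H.
  coords. lra.
Qed.

(** * Crooked planes with director (a, 0, b) in coordinates, and their disjointness criterion *)

(** Orthogonality forces the first coordinate [b / a], nullity leaves the second coordinate only a
    sign, and the positive determinant decides which vector gets which sign. *)
Lemma uplus_uminus_plane (a b r : R) :
  0 < a -> 0 < r -> r * r = a * a - b * b ->
  uplus (vec a 0 b) = vec (b / a) (- (r / a)) 1 /\
  uminus (vec a 0 b) = vec (b / a) (r / a) 1.
Proof.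
  intros Ha Hr Hrr.
  assert (Su : spacelike (vec a 0 b)).
  { split.
    - intro Q. apply (f_equal c1) in Q. cbn in Q. lra.
    - coords. nra. }
  pose proof (null_pairP _ Su) as F.
  destruct (null_frame_perp _ _ _ F) as [Pm Pp].
  destruct F as [[_ Nm] [[_ Np] [Em [Ep [_ D]]]]].
  destruct (uminus (vec a 0 b)) as [[m1 m2] m3], (uplus (vec a 0 b)) as [[q1 q2] q3].
  coords. subst m3 q3.
  assert (m1 = b / a) by (apply Rmult_eq_reg_r with a; [field_simplify; lra|lra]).
  assert (q1 = b / a) by (apply Rmult_eq_reg_r with a; [field_simplify; lra|lra]).
  subst m1 q1.
  assert (T : b / a * (b / a) + r / a * (r / a) = 1).
  { replace (b / a * (b / a) + r / a * (r / a)) with ((b * b + r * r) / (a * a))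
      by (field; lra).
    rewrite Hrr. field; lra. }
  assert (Hra : 0 < r / a) by (apply Rdiv_lt_0_compat; lra).
  assert (Lt : q2 < m2).
  { match type of D with 0 < ?e => replace e with ((m2 - q2) * (r * r / a)) in D
      by (rewrite Hrr; field; lra) end.
    assert (0 < r * r / a) by (apply Rdiv_lt_0_compat; nra). nra. }
  assert (Sq : forall z, z * z = r / a * (r / a) -> z = r / a \/ z = - (r / a)).
  { intros z Hz. assert (Q : (z - r / a) * (z + r / a) = 0) by lra.
    apply Rmult_integral in Q; lra. }
  destruct (Sq m2) as [-> | ->]; [lra| |];
    destruct (Sq q2) as [-> | ->]; try lra; split; reflexivity.
Qed.

(* The crooked plane with vertex 0 and director (1,0,0). *)
Definition standard_crooked (X Y Z : R) : Prop :=
  (X = 0 /\ Y * Y <= Z * Z) \/ (0 < X /\ Y = - Z) \/ (X < 0 /\ Y = Z).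

(** [r] is the length of the director, and the three expressions are the coordinates of [q - p]
    after the boost taking the director to a multiple of (1, 0, 0). This implication is the
    direction that refutes a common point. *)
Lemma crooked_plane_plane (a b r : R) (p q : V) :
  0 < a -> 0 < r -> r * r = a * a - b * b ->
  crooked_plane p (vec a 0 b) q ->
  standard_crooked
    ((a * (c1 q - c1 p) - b * (c3 q - c3 p)) / r)
    (c2 q - c2 p)
    ((a * (c3 q - c3 p) - b * (c1 q - c1 p)) / r).
Proof.
  intros Ha Hr Hrr.
  assert (Su : spacelike (vec a 0 b)).
  { split.
    - intro Q. apply (f_equal c1) in Q. cbn in Q. lra.
    - coords. nra. }
  destruct (uplus_uminus_plane a b r Ha Hr Hrr) as [Up Um].
  unfold crooked_plane.
  change (c1 q - c1 p) with (c1 (minus q p)).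
  change (c2 q - c2 p) with (c2 (minus q p)).
  change (c3 q - c3 p) with (c3 (minus q p)).
  generalize (minus q p). intros x [H | [H | H]].
  - left. destruct H as [H1 H2]. destruct x as [[x y] z]; coords. split.
    + replace (a * x - b * z) with 0 by lra. field; lra.
    + assert (Ex : x = b * z / a)
        by (apply Rmult_eq_reg_r with a; [field_simplify; lra|lra]).
      subst x.
      replace ((a * z - b * (b * z / a)) / r) with ((a * a - b * b) * z / (a * r))
        by (field; lra).
      rewrite <- Hrr.
      replace (r * r * z / (a * r) * (r * r * z / (a * r)))
        with (r * r * (z * z) / (a * a)) by (field; lra).
      replace (r * r * (z * z) / (a * a)) with (z * z - b * z / a * (b * z / a)).
      2: { rewrite Hrr; field; lra. }
      lra.
  - right; left. pose proof (wing_plus_side _ _ Su H) as P.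
    destruct H as [_ [H _]]. rewrite Up in H.
    destruct x as [[x y] z]; coords. split.
    + apply Rdiv_lt_0_compat; lra.
    + apply Rmult_eq_reg_r with (r / a).
      2: { apply Rgt_not_eq, Rdiv_lt_0_compat; lra. }
      replace (- ((a * z - b * x) / r) * (r / a)) with (x * (b / a) - z) by (field; lra).
      lra.
  - right; right. pose proof (wing_minus_side _ _ Su H) as P.
    destruct H as [_ [H _]]. rewrite Um in H.
    destruct x as [[x y] z]; coords. split.
    + assert (0 < (- (a * x - b * z)) / r) by (apply Rdiv_lt_0_compat; lra).
      unfold Rdiv in *; lra.
    + apply Rmult_eq_reg_r with (r / a).
      2: { apply Rgt_not_eq, Rdiv_lt_0_compat; lra. }
      replace ((a * z - b * x) / r * (r / a)) with (z - x * (b / a)) by (field; lra).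
      lra.
Qed.

(* The easy direction of the Drumm-Goldman criterion for ultraparallel
   directors: the displacement of the vertices is the sum of a vector
   (0, D1, B) in the first frame and (0, D2, B') in the second one, with
   D1 + D2 = D > |B| + |B'|; C = cosh and S = sinh of the boost between them. *)
Lemma standard_crooked_disjoint (X Y Z X' Y' Z' C S B B' D : R) :
  standard_crooked X Y Z -> standard_crooked X' Y' Z' ->
  0 < S -> 0 < C -> C * C = 1 + S * S ->
  X = X' * C + (Z' + B') * S ->
  Z = B + X' * S + (Z' + B') * C ->
  Y = Y' + D -> Rabs B + Rabs B' < D -> False.
Proof.
  intros H H' HS HC HCS EX EZ EY HD.
  assert (L : forall x y, x * x <= y * y -> - Rabs y <= x <= Rabs y).
  { intros x y Q. apply Rsqr_le_abs_0 in Q.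
    pose proof (Rle_abs x); pose proof (Rle_abs (- x)).
    rewrite Rabs_Ropp in *; lra. }
  pose proof (Rle_abs B); pose proof (Rle_abs (- B)).
  pose proof (Rle_abs B'); pose proof (Rle_abs (- B')).
  rewrite Rabs_Ropp in *.
  assert (C1 : 1 < C) by nra.
  set (W := Z' + B') in *.
  assert (EZ' : Z' = W - B') by (unfold W; ring). clearbody W.
  (* Multiplying by S and eliminating W through X isolates a term in X'
     whose sign contradicts HD. *)
  assert (EW : S * W = X - X' * C) by lra.
  assert (ES : S * Z = B * S + X * C - X').
  { rewrite EZ. transitivity (B * S + X' * (S * S) + (S * W) * C); [ring|].
    rewrite EW. replace (S * S) with (C * C - 1) by lra. ring. }
  assert (ES' : S * Z' = X - X' * C - S * B') by (rewrite EZ'; lra).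
  destruct H as [[-> H] | [[HX HY] | [HX HY]]];
  destruct H' as [[-> H'] | [[HX' HY'] | [HX' HY']]].
  (* Two stems: [X = X' = 0] gives [W = 0], hence [Z = B] and [Z' = - B'], so [Y - Y'] is at most
     [Rabs B + Rabs B']. A stem against a wing uses [1 < C]: the wing pushes [Y] or [Y'] outside the
     range that the stem allows. *)
  - apply L in H; apply L in H'.
    assert (W = 0) by nra. subst W. replace Z with B in * by lra.
    replace Z' with (- B') in * by lra. rewrite Rabs_Ropp in *. lra.
  - assert (HZ : - (S * Rabs B) - X' <= S * Z <= S * Rabs B + X') by nra.
    assert (HY2 : S * Y > S * Rabs B + X' * C) by (subst Y Y'; nra).
    apply L in H. assert (S * Rabs Z < S * Y).
    { unfold Rabs at 1; destruct (Rcase_abs Z); nra. }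
    nra.
  - assert (HZ : - (S * Rabs B) + X' <= S * Z <= S * Rabs B - X') by nra.
    assert (HY2 : S * Y > S * Rabs B - X' * C) by (subst Y Y'; nra).
    apply L in H. assert (S * Rabs Z < S * Y).
    { unfold Rabs at 1; destruct (Rcase_abs Z); nra. }
    nra.
  - apply L in H'. assert (S * Rabs Z' <= X + S * Rabs B').
    { unfold Rabs at 1; destruct (Rcase_abs Z'); nra. }
    assert (S * Y = - (B * S + X * C)) by (rewrite HY; lra).
    nra.
  (* Two wings: [D] is a signed sum of [Z] and [Z']. In all four cases the terms of [S * D] in [X]
     and [X'] are negative and the others are at most [S * (Rabs B + Rabs B')]. *)
  - assert (S * (Z' - Z) = S * D) by (f_equal; lra). nra.
  - assert (S * (- Z' - Z) = S * D) by (f_equal; lra). nra.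
  - apply L in H'. assert (S * Rabs Z' <= - X + S * Rabs B').
    { unfold Rabs at 1; destruct (Rcase_abs Z'); nra. }
    assert (S * Y = (B * S + X * C)) by (rewrite HY; lra).
    nra.
  - assert (S * (Z + Z') = S * D) by (f_equal; lra). nra.
  - assert (S * (Z - Z') = S * D) by (f_equal; lra). nra.
Qed.

(** * Linear isometries of determinant 1 and their inverses *)

(** The boundedness contained in [is_linear] is inherited from projections, scalings and sums. *)
Lemma is_linear_dot (a : V) : is_linear (fun x : V => dot a x).
Proof.
  apply is_linear_ext with (fun x : V =>
    plus (scal (c1 a) (c1 x)) (plus (scal (c2 a) (c2 x)) (scal (- c3 a) (c3 x)))).
  { intro x; coords. unfold scal, plus; cbn. unfold mult; cbn. ring. }
  assert (S : forall (k : R) (f : V -> R), is_linear f -> is_linear (fun x => scal k (f x))).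
  { intros k f Hf. apply (is_linear_comp f (fun x => scal k x) Hf).
    exact (is_linear_scal_r k Rmult_comm). }
  assert (P : forall f g : V -> R, is_linear f -> is_linear g ->
            is_linear (fun x => plus (f x) (g x))).
  { intros f g Hf Hg.
    apply (is_linear_comp (fun x => (f x, g x)) (fun z => plus (fst z) (snd z))).
    - now apply is_linear_prod.
    - apply is_linear_plus. }
  assert (L1 : is_linear c1).
  { apply (is_linear_comp (fst : V -> R * R) fst); apply is_linear_fst. }
  assert (L2 : is_linear c2).
  { apply (is_linear_comp (fst : V -> R * R) snd); [apply is_linear_fst|apply is_linear_snd]. }
  assert (L3 : is_linear c3) by apply is_linear_snd.
  apply P; [now apply S|apply P; now apply S].
Qed.

Lemma is_linear_vec_dot (a b c : V) :
  is_linear (fun x : V => vec (dot a x) (dot b x) (dot c x)).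
Proof.
  apply (is_linear_prod (fun x => (dot a x, dot b x)) (dot c)).
  - apply is_linear_prod; apply is_linear_dot.
  - apply is_linear_dot.
Qed.

Lemma linear_coords (A : V -> V) (x : V) :
  is_linear A ->
  A x = plus (plus (scal (c1 x) (A (vec 1 0 0))) (scal (c2 x) (A (vec 0 1 0))))
             (scal (c3 x) (A (vec 0 0 1))).
Proof.
  intro L. rewrite <- !(linear_scal A L), <- !(linear_plus A L). f_equal.
  apply V_ext; coords; ring.
Qed.

Lemma isometry_det (A : V -> V) (x y z : V) :
  linear_isometry_det1 A -> det3 (A x) (A y) (A z) = det3 x y z.
Proof.
  intros [L [_ D]].
  rewrite (linear_coords A x L), (linear_coords A y L), (linear_coords A z L).
  transitivity (det3 x y z * det3 (A (vec 1 0 0)) (A (vec 0 1 0)) (A (vec 0 0 1))).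
  - generalize (A (vec 1 0 0)) (A (vec 0 1 0)) (A (vec 0 0 1)); intros a b c.
    destruct x as [[x1 x2] x3], y as [[y1 y2] y3], z as [[z1 z2] z3],
      a as [[a1 a2] a3], b as [[b1 b2] b3], c as [[d1 d2] d3].
    coords. ring.
  - rewrite D; ring.
Qed.

(** The adjoint of [A] for the Lorentzian product; the third row carries a sign because the third
    basis vector has square -1. *)
Definition isometry_inverse (A : V -> V) (y : V) : V :=
  vec (dot (A (vec 1 0 0)) y) (dot (A (vec 0 1 0)) y)
      (dot (opp (A (vec 0 0 1))) y).

Lemma isometry_inverse_l (A : V -> V) (x : V) :
  linear_isometry_det1 A -> isometry_inverse A (A x) = x.
Proof.
  intros [_ [I _]]. unfold isometry_inverse.
  replace (dot (opp (A (vec 0 0 1))) (A x)) with (- dot (A (vec 0 0 1)) (A x))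
    by (coords; ring).
  rewrite !I. apply V_ext; coords; ring.
Qed.

(** Cramer's rule: the determinant times each coordinate of [z] is a combination of the three
    products, with cofactors as coefficients. *)
Lemma dot_nondegenerate (a b d z : V) :
  det3 a b d <> 0 -> dot a z = 0 -> dot b z = 0 -> dot d z = 0 -> z = zero.
Proof.
  intros D Ha Hb Hd.
  destruct a as [[a1 a2] a3], b as [[b1 b2] b3], d as [[d1 d2] d3], z as [[z1 z2] z3].
  coords.
  assert (K : forall w, (a1 * (b2 * d3 - b3 * d2) - a2 * (b1 * d3 - b3 * d1) +
     a3 * (b1 * d2 - b2 * d1)) * w = 0 -> w = 0).
  { intros w Hw. apply Rmult_integral in Hw. tauto. }
  apply V_ext; cbn; apply K.
  - transitivity ((a1 * z1 + a2 * z2 - a3 * z3) * (b2 * d3 - b3 * d2)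
      + (b1 * z1 + b2 * z2 - b3 * z3) * (d2 * a3 - d3 * a2)
      + (d1 * z1 + d2 * z2 - d3 * z3) * (a2 * b3 - a3 * b2)); [ring|].
    rewrite Ha, Hb, Hd; ring.
  - transitivity ((a1 * z1 + a2 * z2 - a3 * z3) * (b3 * d1 - b1 * d3)
      + (b1 * z1 + b2 * z2 - b3 * z3) * (d3 * a1 - d1 * a3)
      + (d1 * z1 + d2 * z2 - d3 * z3) * (a3 * b1 - a1 * b3)); [ring|].
    rewrite Ha, Hb, Hd; ring.
  - transitivity (- ((a1 * z1 + a2 * z2 - a3 * z3) * (b1 * d2 - b2 * d1)
      + (b1 * z1 + b2 * z2 - b3 * z3) * (d1 * a2 - d2 * a1)
      + (d1 * z1 + d2 * z2 - d3 * z3) * (a1 * b2 - a2 * b1))); [ring|].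
    rewrite Ha, Hb, Hd; ring.
Qed.

Lemma minus_zero_eq (x y : V) : minus x y = zero -> x = y.
Proof.
  destruct x as [[x1 x2] x3], y as [[y1 y2] y3]. intro H.
  injection H as H1 H2 H3. unfold plus, opp in *; cbn in *.
  apply V_ext; cbn; lra.
Qed.

(** The difference of the two sides is orthogonal to the image of [A], which contains three
    independent vectors. *)
Lemma isometry_inverse_r (A : V -> V) (y : V) :
  linear_isometry_det1 A -> A (isometry_inverse A y) = y.
Proof.
  intros [L [I D]].
  assert (O : forall x, dot (A x) (minus (A (isometry_inverse A y)) y) = 0).
  { intro x. rewrite dot_sym, dot_minus_l, (dot_sym _ (A x)), I, (dot_sym y).
    rewrite (linear_coords A x L). unfold isometry_inverse.
    generalize (A (vec 1 0 0)) (A (vec 0 1 0)) (A (vec 0 0 1)).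
    intros [[a1 a2] a3] [[b1 b2] b3] [[d1 d2] d3].
    destruct x as [[x1 x2] x3], y as [[y1 y2] y3]. coords.
    unfold plus, opp; cbn; ring. }
  apply minus_zero_eq.
  apply (dot_nondegenerate (A (vec 1 0 0)) (A (vec 0 1 0)) (A (vec 0 0 1)));
    [rewrite D; lra|apply O..].
Qed.

Lemma isometry_zero (A : V -> V) (x : V) :
  linear_isometry_det1 A -> A x = zero -> x = zero.
Proof.
  intros H E. rewrite <- (isometry_inverse_l A x H), E.
  unfold isometry_inverse. apply V_ext; coords; ring.
Qed.

Lemma isometry_spacelike (A : V -> V) (x : V) :
  linear_isometry_det1 A -> spacelike x -> spacelike (A x).
Proof.
  intros H [N P]; split.
  - intro E. now apply N, (isometry_zero A).
  - destruct H as [_ [I _]]. now rewrite I.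
Qed.

(** * Action of isometries on null frames and crooked planes *)

Lemma null_third_coord (n : V) : null n -> c3 n <> 0.
Proof.
  intros [N Z] E. apply N. destruct n as [[x y] z]; coords. subst z.
  assert (Q : Rsqr x + Rsqr y = 0) by (unfold Rsqr; lra).
  apply Rplus_sqr_eq_0 in Q; destruct Q as [-> ->]. now apply V_ext.
Qed.

Lemma null_same_time_sign (n n' : V) :
  null n -> null n' -> dot n n' < 0 -> 0 < c3 n * c3 n'.
Proof.
  intros [_ N] [_ N'] H.
  destruct n as [[x y] z], n' as [[x' y'] z']; coords.
  destruct (Rlt_le_dec 0 (z * z')) as [P | P]; [exact P|exfalso].
  (* Cauchy-Schwarz *)
  assert (Q : (x * x' + y * y') * (x * x' + y * y') <= (z * z') * (z * z')).
  { replace ((z * z') * (z * z')) with ((x * x + y * y) * (x' * x' + y' * y')).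
    - pose proof (Rle_0_sqr (x * y' - y * x')); unfold Rsqr in *; lra.
    - replace (x * x + y * y) with (z * z) by lra.
      replace (x' * x' + y' * y') with (z' * z') by lra. ring. }
  nra.
Qed.

(** With third coordinates 1, the product is minus half the squared distance of the planar parts; it
    vanishes only if [m = p], which the determinant excludes. *)
Lemma null_frame_dot_neg (u m p : V) : null_frame u m p -> dot m p < 0.
Proof.
  intros [[_ Nm] [[_ Np] [Em [Ep [_ D]]]]].
  destruct u as [[u1 u2] u3], m as [[m1 m2] m3], p as [[p1 p2] p3]; coords.
  subst m3 p3.
  assert (Q : 0 <= (m1 - p1) * (m1 - p1) + (m2 - p2) * (m2 - p2)).
  { apply Rplus_le_le_0_compat; apply Rle_0_sqr. }
  destruct (Req_dec (m1 * p1 + m2 * p2 - 1 * 1) 0) as [E | E]; [|lra].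
  assert (Z : Rsqr (m1 - p1) + Rsqr (m2 - p2) = 0) by (unfold Rsqr; lra).
  apply Rplus_sqr_eq_0 in Z. destruct Z.
  assert (m1 = p1) by lra. assert (m2 = p2) by lra. subst. lra.
Qed.

Definition time_normalize (n : V) : V := scal (/ c3 n) n.

Lemma null_time_normalize (n : V) :
  null n -> null (time_normalize n) /\ c3 (time_normalize n) = 1.
Proof.
  intro N. pose proof (null_third_coord n N) as Z.
  assert (E : c3 (time_normalize n) = 1).
  { destruct n as [[x y] z]; unfold time_normalize; coords. field; exact Z. }
  split; [split|exact E].
  - intro Q. rewrite Q in E. coords; lra.
  - destruct N as [_ N]. unfold time_normalize.
    rewrite dot_scal_l, dot_sym, dot_scal_l, N. ring.
Qed.

(* An isometry of determinant 1 may reverse time; it then reverses both null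
   directions, so the orientation of the frame is kept. *)
Lemma isometry_null_frame (A : V -> V) (u m p : V) :
  linear_isometry_det1 A -> null_frame u m p ->
  null_frame (A u) (time_normalize (A m)) (time_normalize (A p)).
Proof.
  intros H F. pose proof (null_frame_dot_neg _ _ _ F) as MP.
  destruct F as [Nm [Np [_ [_ [S D]]]]].
  pose proof H as [L [I _]].
  assert (NA : forall n, null n -> null (A n)).
  { intros n [N Z]; split.
    - intro Q. now apply N, (isometry_zero A).
    - now rewrite I. }
  pose proof (NA _ Nm) as NAm. pose proof (NA _ Np) as NAp.
  pose proof (null_third_coord _ NAm) as Zm. pose proof (null_third_coord _ NAp) as Zp.
  destruct (null_time_normalize _ NAm) as [N1 T1].
  destruct (null_time_normalize _ NAp) as [N2 T2].
  do 4 (split; [assumption|]). split.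
  - intro x. rewrite <- (isometry_inverse_r A x H) at 1. rewrite I, S. split.
    + intros [a [b E]]. exists (a * c3 (A m)), (b * c3 (A p)).
      rewrite <- (isometry_inverse_r A x H), E.
      rewrite (linear_plus A L), !(linear_scal A L). unfold time_normalize.
      destruct (A m) as [[x1 x2] x3], (A p) as [[y1 y2] y3]; coords.
      apply V_ext; cbn; unfold mult; cbn; field; split; assumption.
    + intros [a [b E]]. exists (a / c3 (A m)), (b / c3 (A p)).
      rewrite E. etransitivity; [|apply (isometry_inverse_l A _ H)]. f_equal.
      rewrite (linear_plus A L), !(linear_scal A L). unfold time_normalize.
      destruct (A m) as [[x1 x2] x3], (A p) as [[y1 y2] y3]; coords.
      apply V_ext; cbn; unfold mult; cbn; field; split; assumption.
  - rewrite <- (isometry_det A _ _ _ H) in D.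
    assert (0 < c3 (A m) * c3 (A p)) by (apply null_same_time_sign; now rewrite ?I).
    replace (det3 (A u) (time_normalize (A m)) (time_normalize (A p)))
      with (det3 (A u) (A m) (A p) / (c3 (A m) * c3 (A p))).
    + now apply Rdiv_lt_0_compat.
    + unfold time_normalize. generalize dependent (A u).
      destruct (A m) as [[x y] z], (A p) as [[x' y'] z'].
      intros [[u1 u2] u3] _. coords. field; split; assumption.
Qed.

Lemma isometry_null_pair (A : V -> V) (u : V) :
  linear_isometry_det1 A -> spacelike u ->
  uminus (A u) = time_normalize (A (uminus u)) /\
  uplus (A u) = time_normalize (A (uplus u)).
Proof.
  intros H Hu. apply (null_frame_unique (A u)).
  - now apply isometry_null_frame, null_pairP.
  - now apply null_pairP, isometry_spacelike.
Qed.

Lemma isometry_crooked_plane (A : V -> V) (c : V) (p u q : V) :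
  linear_isometry_det1 A -> spacelike u ->
  crooked_plane p u q -> crooked_plane (plus (A p) c) (A u) (plus (A q) c).
Proof.
  intros H Hu. pose proof H as [L [I _]]. unfold crooked_plane.
  replace (minus (plus (A q) c) (plus (A p) c)) with (A (minus q p)).
  2: { rewrite (linear_minus A _ _ L). apply V_ext; coords; unfold minus, plus, opp; cbn; ring. }
  generalize (minus q p); intro x.
  destruct (isometry_null_pair A u H Hu) as [Em Ep].
  intros [[S1 S2] | [[W1 [W2 W3]] | [W1 [W2 W3]]]].
  - left; split; now rewrite I.
  - right; left. destruct (isometry_null_pair A x H W1) as [_ Ex].
    split; [now apply isometry_spacelike|]. rewrite Ep; split.
    + unfold time_normalize. rewrite dot_sym, dot_scal_l, I, dot_sym, W2. ring.
    + now rewrite Ex, W3.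
  - right; right. destruct (isometry_null_pair A x H W1) as [_ Ex].
    split; [now apply isometry_spacelike|]. rewrite Em; split.
    + unfold time_normalize. rewrite dot_sym, dot_scal_l, I, dot_sym, W2. ring.
    + now rewrite Ex, W3.
Qed.

(** * Transport of foliations under changes of coordinates *)

(** Vertices and directors themselves are matched, not just the sets, so that they can be carried
    through an isometry. *)
Definition foliation_through (p0 : E) (u0 : V) (p1 : E) (u1 : V) : Prop :=
  exists (p : R -> E) (u : R -> V), crooked_foliation p u /\
    (exists s : R, p s = p0 /\ u s = u0) /\ (exists t : R, p t = p1 /\ u t = u1).

Lemma smooth_dot (a : V) (p : R -> V) :
  smooth (fun t => c1 (p t)) -> smooth (fun t => c2 (p t)) ->
  smooth (fun t => c3 (p t)) -> smooth (fun t => dot a (p t)).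
Proof.
  intros S1 S2 S3 n t. unfold dot.
  apply ex_derive_n_minus; apply filter_forall; intros y k _.
  - apply ex_derive_n_plus; apply filter_forall; intros z j _;
      apply ex_derive_n_scal_l; [apply S1|apply S2].
  - apply ex_derive_n_scal_l; apply S3.
Qed.

Lemma Derive_dot (a : V) (p : R -> V) (t : R) :
  smooth (fun t => c1 (p t)) -> smooth (fun t => c2 (p t)) ->
  smooth (fun t => c3 (p t)) ->
  Derive (fun t => dot a (p t)) t =
  dot a (vec (Derive (fun s => c1 (p s)) t) (Derive (fun s => c2 (p s)) t)
             (Derive (fun s => c3 (p s)) t)).
Proof.
  intros S1 S2 S3. pose proof (S1 1%nat t) as D1. pose proof (S2 1%nat t) as D2.
  pose proof (S3 1%nat t) as D3. cbn in D1, D2, D3.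
  apply is_derive_unique. unfold dot.
  apply (is_derive_minus (fun t => c1 a * c1 (p t) + c2 a * c2 (p t))
           (fun t => c3 a * c3 (p t))).
  - apply (is_derive_plus (fun t => c1 a * c1 (p t)) (fun t => c2 a * c2 (p t)));
      apply is_derive_scal, Derive_correct; assumption.
  - apply is_derive_scal, Derive_correct; assumption.
Qed.

Lemma smooth_minus_const (f : R -> R) (k : R) : smooth f -> smooth (fun t => f t - k).
Proof.
  intros S n t. apply ex_derive_n_minus; apply filter_forall; intros y j _.
  - apply S.
  - apply ex_derive_n_const.
Qed.

(** The inverse of [A] is linear, so it keeps continuity, smoothness and nonzero tangents; a common
    point of two pulled-back planes is mapped to a common point of the original ones. *)
Lemma foliation_through_pullback (A : V -> V) (c : V) (p0 u0 p1 u1 : V) :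
  linear_isometry_det1 A ->
  foliation_through (plus (A p0) c) (A u0) (plus (A p1) c) (A u1) ->
  foliation_through p0 u0 p1 u1.
Proof.
  intros H [p [u [[Sp [Cu [[S1 [S2 [S3 Rg]]] Dj]]] [[s [Ps Us]] [t [Pt Ut]]]]]].
  set (B := isometry_inverse A).
  exists (fun t => B (minus (p t) c)), (fun t => B (u t)).
  assert (AB : forall x, A (B x) = x) by (intro; now apply isometry_inverse_r).
  assert (BA : forall x, B (A x) = x) by (intro; now apply isometry_inverse_l).
  assert (PM : forall x y : V, minus (plus x y) y = x).
  { intros x y. apply V_ext; coords; unfold minus, plus, opp; cbn; ring. }
  assert (MP : forall x y : V, plus (minus x y) y = x).
  { intros x y. apply V_ext; coords; unfold minus, plus, opp; cbn; ring. }
  split; [|split; [exists s|exists t]; rewrite ?Ps, ?Us, ?Pt, ?Ut, PM, !BA; auto].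
  assert (Su : forall t, spacelike (B (u t))).
  { intro r. destruct (Sp r) as [N P]; split.
    - intro Z. apply N. rewrite <- (AB (u r)), Z. destruct H as [L _]. exact (linear_zero A L).
    - destruct H as [_ [I _]]. rewrite <- I, AB. exact P. }
  assert (T1 : smooth (fun t => c1 (minus (p t) c)))
    by exact (smooth_minus_const _ (c1 c) S1).
  assert (T2 : smooth (fun t => c2 (minus (p t) c)))
    by exact (smooth_minus_const _ (c2 c) S2).
  assert (T3 : smooth (fun t => c3 (minus (p t) c)))
    by exact (smooth_minus_const _ (c3 c) S3).
  split; [exact Su|split; [|split]].
  - intro r. apply (continuous_comp u B); [apply Cu|].
    apply (linear_cont (U := prod_NormedModule _ (prod_NormedModule _ R_NormedModule R_NormedModule) R_NormedModule) (V := prod_NormedModule _ (prod_NormedModule _ R_NormedModule R_NormedModule) R_NormedModule)), is_linear_vec_dot.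
  - split; [|split; [|split]].
    + apply (smooth_dot _ _ T1 T2 T3).
    + apply (smooth_dot _ _ T1 T2 T3).
    + apply (smooth_dot _ _ T1 T2 T3).
    + intros r Z. apply (Rg r).
      assert (DM : forall f : R -> R, smooth f -> forall k,
                 Derive (fun t => f t - k) r = Derive f r).
      { intros f Sf k. rewrite Derive_minus, Derive_const; [ring|apply (Sf 1%nat)|].
        apply ex_derive_const. }
      set (w := vec _ _ _).
      rewrite <- (AB w).
      replace (B w) with (zero : V); [destruct H as [L _]; exact (linear_zero A L)|].
      rewrite <- Z. unfold B, isometry_inverse.
      assert (Ew : w = vec (Derive (fun s => c1 (minus (p s) c)) r)
         (Derive (fun s => c2 (minus (p s) c)) r)
         (Derive (fun s => c3 (minus (p s) c)) r)).
      { unfold w. rewrite <- (DM _ S1 (c1 c)), <- (DM _ S2 (c2 c)), <- (DM _ S3 (c3 c)).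
        reflexivity. }
      rewrite Ew, <- !(Derive_dot _ _ _ T1 T2 T3). reflexivity.
  - intros r r' Hr q [Q Q'].
    apply (Dj r r' Hr (plus (A q) c)); split.
    + apply (isometry_crooked_plane A c) in Q; [|exact H|apply Su].
      now rewrite !AB, MP in Q.
    + apply (isometry_crooked_plane A c) in Q'; [|exact H|apply Su].
      now rewrite !AB, MP in Q'.
Qed.

(** * Hyperbolic functions *)

Lemma cosh_sqr (x : R) : cosh x * cosh x = 1 + sinh x * sinh x.
Proof.
  unfold cosh, sinh.
  assert (exp x * exp (- x) = 1) by (rewrite <- exp_plus, Rplus_opp_r; apply exp_0).
  lra.
Qed.

Lemma cosh_pos (x : R) : 0 < cosh x.
Proof. unfold cosh. pose proof (exp_pos x); pose proof (exp_pos (- x)); lra. Qed.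

Lemma sinh_opp (x : R) : sinh (- x) = - sinh x.
Proof. unfold sinh. rewrite Ropp_involutive. field. Qed.

Lemma cosh_opp (x : R) : cosh (- x) = cosh x.
Proof. unfold cosh. rewrite Ropp_involutive. field. Qed.

Lemma sinh_plus (x y : R) : sinh (x + y) = sinh x * cosh y + cosh x * sinh y.
Proof. unfold sinh, cosh. rewrite Ropp_plus_distr, !exp_plus. field. Qed.

Lemma cosh_plus (x y : R) : cosh (x + y) = cosh x * cosh y + sinh x * sinh y.
Proof. unfold sinh, cosh. rewrite Ropp_plus_distr, !exp_plus. field. Qed.

Lemma sinh_pos (x : R) : 0 < x -> 0 < sinh x.
Proof.
  intro H. unfold sinh. assert (exp (- x) < exp x) by (apply exp_increasing; lra). lra.
Qed.

(** This is tanh x < x: the derivative of [t * cosh t - sinh t] is [t * sinh t], positive for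
    [t > 0]. *)
Lemma sinh_lt_mul_cosh (x : R) : 0 < x -> sinh x < x * cosh x.
Proof.
  intro Hx.
  destruct (MVT_cor2 (fun t => t * cosh t - sinh t) (fun t => t * sinh t) 0 x Hx)
    as [z [E Hz]].
  - intros t _. apply is_derive_Reals. auto_derive; [exact I|ring].
  - rewrite sinh_0 in E. pose proof (sinh_pos z (proj1 Hz)).
    assert (0 < z * sinh z * (x - 0)) by (apply Rmult_lt_0_compat; nra). lra.
Qed.

Lemma sinh_ge_quadratic (x : R) : 0 < x -> x * x / 8 <= sinh x.
Proof.
  intro H. unfold sinh.
  assert (exp (- x) < 1) by (rewrite <- exp_0; apply exp_increasing; lra).
  pose proof (exp_ineq1_le (x / 2)).
  assert (E : exp x = exp (x / 2) * exp (x / 2)) by (rewrite <- exp_plus; f_equal; field).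
  assert ((1 + x / 2) * (1 + x / 2) <= exp x) by (rewrite E; nra). lra.
Qed.

Lemma linear_le_sinh_eventually (lam K e : R) :
  0 < lam -> 0 < K -> 0 < e -> exists s : R, lam < s /\ K * s <= e * sinh s.
Proof.
  (* With [s >= 8 * K / e], the quadratic bound [s * s / 8 <= sinh s] already gives the claim;
     adding [lam] ensures [lam < s]. *)
  intros Hl HK He. exists (lam + 8 * K / e).
  assert (H : 0 < 8 * K / e) by (apply Rdiv_lt_0_compat; lra).
  split; [lra|].
  set (s := lam + 8 * K / e).
  assert (Hs : 8 * K <= e * s).
  { replace (8 * K) with (e * (8 * K / e)) by (field; lra). unfold s; nra. }
  pose proof (sinh_ge_quadratic s ltac:(unfold s; lra)).
  assert (0 < s) by (unfold s; lra).
  assert (8 * K * s <= e * s * s) by nra. nra.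
Qed.

(** The span of cosh, sinh, t and 1 is closed under differentiation. *)
Lemma Derive_n_hyperbolic (n : nat) : forall a b c d : R,
  exists a' b' c' d' : R, forall t : R,
    Derive_n (fun t => a * cosh t + b * sinh t + c * t + d) n t =
    a' * cosh t + b' * sinh t + c' * t + d'.
Proof.
  induction n as [|n IH]; intros a b c d.
  - now exists a, b, c, d.
  - destruct (IH a b c d) as [a' [b' [c' [d' E]]]].
    exists b', a', 0, c'. intro t. cbn. rewrite (Derive_ext _ _ _ E).
    apply is_derive_unique. auto_derive; [exact I|ring].
Qed.

Lemma smooth_hyperbolic (a b c d : R) :
  smooth (fun t => a * cosh t + b * sinh t + c * t + d).
Proof.
  intros [|n] t; [exact I|].
  destruct (Derive_n_hyperbolic n a b c d) as [a' [b' [c' [d' E]]]].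
  cbn. apply ex_derive_ext with (fun t => a' * cosh t + b' * sinh t + c' * t + d').
  - intro s; symmetry; apply E.
  - auto_derive. exact I.
Qed.

Lemma smooth_ext (f g : R -> R) : (forall t, f t = g t) -> smooth f -> smooth g.
Proof. intros E S n t. exact (ex_derive_n_ext f g n t E (S n t)). Qed.

(** * The foliation along a hyperbola-like curve *)

(** The planar displacement is split along (S, C) and (S', C'), orthogonal to the two directors. In
    the boosted frames this is [standard_crooked_disjoint], where the addition formulas give the
    cosh and sinh of the relative boost. *)
Lemma crooked_planes_disjoint (k k' C S C' S' B B' : R) (p p' : V) :
  0 < k -> 0 < k' -> 0 < C -> 0 < C' ->
  C * C = 1 + S * S -> C' * C' = 1 + S' * S' -> 0 < C * S' - S * C' ->
  c1 p' - c1 p = B * S + B' * S' -> c3 p' - c3 p = B * C + B' * C' ->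
  Rabs B + Rabs B' < c2 p' - c2 p ->
  disjoint (crooked_plane p (vec (k * C) 0 (k * S)))
           (crooked_plane p' (vec (k' * C') 0 (k' * S'))).
Proof.
  intros Hk Hk' HC HC' E E' HS E1 E3 E2 q [Q Q'].
  apply (crooked_plane_plane (k * C) (k * S) k) in Q; [|nra|exact Hk|].
  2: { replace (k * C * (k * C)) with (k * k * (C * C)) by ring. rewrite E; ring. }
  apply (crooked_plane_plane (k' * C') (k' * S') k') in Q'; [|nra|exact Hk'|].
  2: { replace (k' * C' * (k' * C')) with (k' * k' * (C' * C')) by ring. rewrite E'; ring. }
  assert (F : forall k C S x z, 0 < k ->
    (k * C * x - k * S * z) / k = C * x - S * z) by (intros; field; lra).
  rewrite !F in Q, Q' by assumption.
  set (x := c1 q - c1 p') in *. set (y := c2 q - c2 p') in *. set (z := c3 q - c3 p') in *.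
  replace (c1 q - c1 p) with (x + (B * S + B' * S')) in Q by (unfold x; lra).
  replace (c2 q - c2 p) with (y + (c2 p' - c2 p)) in Q by (unfold y; lra).
  replace (c3 q - c3 p) with (z + (B * C + B' * C')) in Q by (unfold z; lra).
  assert (LS : - C < S < C /\ - C' < S' < C') by (repeat split; nra).
  apply (standard_crooked_disjoint _ _ _ _ _ _ (C * C' - S * S') (C * S' - S * C')
           B B' (c2 p' - c2 p) Q Q'); auto.
  - nra.
  - transitivity ((C * C) * (C' * C') - 2 * C * C' * S * S' + S * S * (S' * S')); [ring|].
    transitivity (1 + ((C * C) * (S' * S') - 2 * C * C' * S * S' + S * S * (C' * C')));
      [|ring].
    rewrite E, E'; ring.
  - transitivity ((C * x - S * z) * (C' * C' - S' * S') + B' * (C * S' - S * C'));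
      [|ring].
    rewrite E'; ring.
  - transitivity (B * (C * C - S * S) + (C * z - S * x) * (C' * C' - S' * S')
      + B' * (C * C' - S * S')); [rewrite E'; ring|rewrite E; ring].
Qed.

(** The planar tangent [d * (c * sinh s, cosh s)] is orthogonal to the director at the same
    parameter. *)
Definition hyperbola_vertex (a c d x0 s : R) : V :=
  vec (c * d * cosh s + x0) (a * sinh s + Rabs d * s) (d * sinh s).

Definition hyperbola_director (c k s : R) : V := vec (k * cosh s) 0 (k * (c * sinh s)).

(* The planar displacement from s to t is mu d times the sum of the two
   (c sinh, cosh) vectors, with mu = tanh ((t - s) / 2), because
   sinh t - sinh s = mu (cosh s + cosh t) and
   cosh t - cosh s = mu (sinh s + sinh t). *)
Lemma hyperbola_disjoint (a c d k x0 s t : R) :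
  0 < c -> c < 1 -> 0 <= a -> d <> 0 -> d * d * (1 - c * c) <= a * a -> 0 < k -> s < t ->
  disjoint
    (crooked_plane (hyperbola_vertex a c d x0 s) (hyperbola_director c k s))
    (crooked_plane (hyperbola_vertex a c d x0 t) (hyperbola_director c k t)).
Proof.
  intros Hc Hc1 Ha Hd Hac Hk Hst.
  assert (Hd' : 0 < Rabs d) by now apply Rabs_pos_lt.
  assert (Edd : Rabs d * Rabs d = d * d) by (unfold Rabs; destruct (Rcase_abs d); ring).
  (* [r] is the length of (cosh x, 0, c sinh x). The square of [Rabs d * r] is [d * d + d * d * (1 -
     c * c) * (sinh x * sinh x)], which the hypothesis on [a] bounds by the square of the right
     side. *)
  assert (G : forall x, exists r, 0 < r /\
     r * r = cosh x * cosh x - c * sinh x * (c * sinh x) /\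
     Rabs d * r <= a * cosh x + Rabs d).
  { intro x. pose proof (cosh_sqr x) as Ex. pose proof (cosh_pos x) as Px.
    assert (Hn : 0 < cosh x * cosh x - c * sinh x * (c * sinh x)).
    { rewrite Ex. pose proof (Rle_0_sqr (sinh x)). unfold Rsqr in *.
      assert (0 <= sinh x * sinh x * (1 - c * c)) by (apply Rmult_le_pos; nra). lra. }
    exists (sqrt (cosh x * cosh x - c * sinh x * (c * sinh x))).
    split; [now apply sqrt_lt_R0|].
    assert (Er : sqrt (cosh x * cosh x - c * sinh x * (c * sinh x)) *
      sqrt (cosh x * cosh x - c * sinh x * (c * sinh x)) =
      cosh x * cosh x - c * sinh x * (c * sinh x)) by (apply sqrt_sqrt; lra).
    split; [exact Er|].
    set (r := sqrt _) in *.
    apply Rsqr_incr_0_var; [|nra]. unfold Rsqr.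
    replace (Rabs d * r * (Rabs d * r)) with (Rabs d * Rabs d * (r * r)) by ring.
    rewrite Er, Edd, Ex.
    replace (d * d * (1 + sinh x * sinh x - c * sinh x * (c * sinh x)))
      with (d * d + d * d * (1 - c * c) * (sinh x * sinh x)) by ring.
    assert (0 <= sinh x * sinh x) by apply Rle_0_sqr.
    assert (d * d * (1 - c * c) * (sinh x * sinh x) <= a * a * (sinh x * sinh x))
      by now apply Rmult_le_compat_r.
    assert (a * a * (sinh x * sinh x) <= a * a * (cosh x * cosh x))
      by (apply Rmult_le_compat_l; nra).
    assert (0 <= a * cosh x * Rabs d) by (apply Rmult_le_pos; nra).
    lra. }
  destruct (G s) as [r [Pr [Er Br]]], (G t) as [r' [Pr' [Er' Br']]]. clear G.
  pose proof (cosh_pos s); pose proof (cosh_pos t).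
  set (m := (s + t) / 2). set (h := (t - s) / 2).
  assert (Hh : 0 < h) by (unfold h; lra).
  pose proof (sinh_lt_mul_cosh h Hh) as Hsh. pose proof (cosh_pos h) as Ph.
  pose proof (sinh_pos h Hh) as Psh.
  set (mu := sinh h / cosh h).
  assert (Hmu : 0 < mu) by now apply Rdiv_lt_0_compat.
  (* Here tanh h < h enters; the term [Rabs d * s] of the vertex turns it into the strict inequality
     of the criterion. *)
  assert (Hmuh : 2 * mu < t - s).
  { replace (t - s) with (2 * h) by (unfold h; lra).
    assert (mu < h); [|lra]. unfold mu. apply Rmult_lt_reg_r with (cosh h); [exact Ph|].
    replace (sinh h / cosh h * cosh h) with (sinh h) by (field; lra). exact Hsh. }
  assert (Es : s = m + - h) by (unfold m, h; lra).
  assert (Et : t = m + h) by (unfold m, h; lra).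
  assert (M1 : sinh t - sinh s = mu * (cosh s + cosh t)).
  { rewrite Es, Et, !sinh_plus, !cosh_plus, sinh_opp, cosh_opp. unfold mu. field; lra. }
  assert (M2 : cosh t - cosh s = mu * (sinh s + sinh t)).
  { rewrite Es, Et, !sinh_plus, !cosh_plus, sinh_opp, cosh_opp. unfold mu. field; lra. }
  assert (Hdir : forall x r, 0 < r -> hyperbola_director c k x =
     vec (k * r * (cosh x / r)) 0 (k * r * (c * sinh x / r))).
  { intros x q Hq. apply V_ext; coords; field; lra. }
  rewrite (Hdir s r Pr), (Hdir t r' Pr').
  assert (Hunit : forall x q, 0 < q ->
     q * q = cosh x * cosh x - c * sinh x * (c * sinh x) ->
     cosh x / q * (cosh x / q) = 1 + c * sinh x / q * (c * sinh x / q)).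
  { intros x q Hq Eq. apply Rmult_eq_reg_r with (q * q); [|nra].
    field_simplify; lra. }
  (* The factors [r] and [r'] compensate the normalization of the two directors. *)
  apply (crooked_planes_disjoint _ _ _ _ _ _ (d * mu * r) (d * mu * r')).
  - nra.
  - nra.
  - now apply Rdiv_lt_0_compat.
  - now apply Rdiv_lt_0_compat.
  - now apply Hunit.
  - now apply Hunit.
  - replace (cosh s / r * (c * sinh t / r') - c * sinh s / r * (cosh t / r'))
      with (c * sinh (t + - s) / (r * r')).
    + apply Rdiv_lt_0_compat; [|nra].
      apply Rmult_lt_0_compat; [exact Hc|apply sinh_pos; lra].
    + rewrite sinh_plus, cosh_opp, sinh_opp. field; lra.
  - unfold hyperbola_vertex; coords.
    transitivity (c * d * (cosh t - cosh s)); [ring|]. rewrite M2. field; lra.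
  - unfold hyperbola_vertex; coords.
    transitivity (d * (sinh t - sinh s)); [ring|]. rewrite M1. field; lra.
  - assert (Eabs : forall q, 0 < q -> Rabs (d * mu * q) = mu * (Rabs d * q)).
    { intros q Hq. rewrite !Rabs_mult, (Rabs_pos_eq mu), (Rabs_pos_eq q) by lra. ring. }
    rewrite !Eabs by assumption.
    unfold hyperbola_vertex; coords.
    assert (mu * (Rabs d * r) + mu * (Rabs d * r') <=
       mu * (a * cosh s + Rabs d) + mu * (a * cosh t + Rabs d))
      by (apply Rplus_le_compat; apply Rmult_le_compat_l; lra).
    assert (mu * (a * cosh s + Rabs d) + mu * (a * cosh t + Rabs d)
       = a * (sinh t - sinh s) + Rabs d * (2 * mu)) by (rewrite M1; ring).
    assert (Rabs d * (2 * mu) < Rabs d * (t - s)) by now apply Rmult_lt_compat_l.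
    lra.
Qed.

Lemma hyperbola_foliation (a c d k x0 : R) :
  0 < c -> c < 1 -> 0 <= a -> d <> 0 -> d * d * (1 - c * c) <= a * a -> 0 < k ->
  crooked_foliation (hyperbola_vertex a c d x0) (hyperbola_director c k).
Proof.
  intros Hc Hc1 Ha Hd Hac Hk. split; [|split; [|split]].
  - intro s. pose proof (cosh_sqr s). pose proof (cosh_pos s). split.
    + intro Z. apply (f_equal c1) in Z. coords. nra.
    + unfold hyperbola_director; coords.
      replace (k * cosh s * (k * cosh s) + 0 * 0 - k * (c * sinh s) * (k * (c * sinh s)))
        with (k * k * (cosh s * cosh s - c * c * (sinh s * sinh s))) by ring.
      assert (0 <= sinh s * sinh s) by apply Rle_0_sqr.
      assert (0 <= (1 - c * c) * (sinh s * sinh s)) by (apply Rmult_le_pos; nra).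
      apply Rmult_lt_0_compat; nra.
  - intro s.
    apply continuous_ext with
      (fun s : R => plus (scal (cosh s) (vec k 0 0)) (scal (sinh s) (vec 0 0 (k * c)))).
    { intro t. apply V_ext; coords; unfold plus, scal; cbn; unfold mult; cbn; ring. }
    assert (K : forall (f : R -> R) (v : V), ex_derive f s ->
              continuous (fun s => scal (f s) v) s).
    { intros f v Hf. apply (continuous_comp f (fun x => scal x v)).
      - now apply (ex_derive_continuous f).
      - apply (linear_cont (fun x : R => scal x v)).
        exact (is_linear_scal_l (K := R_AbsRing) (V := prod_NormedModule _
          (prod_NormedModule _ R_NormedModule R_NormedModule) R_NormedModule) v). }
    apply (continuous_plus (fun s : R => scal (cosh s) (vec k 0 0))
             (fun s : R => scal (sinh s) (vec 0 0 (k * c)))); apply K; auto_derive; exact I.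
  - split; [|split; [|split]].
    + apply smooth_ext with (2 := smooth_hyperbolic (c * d) 0 0 x0).
      intro t; unfold hyperbola_vertex; coords; ring.
    + apply smooth_ext with (2 := smooth_hyperbolic 0 a (Rabs d) 0).
      intro t; unfold hyperbola_vertex; coords; ring.
    + apply smooth_ext with (2 := smooth_hyperbolic 0 d 0 0).
      intro t; unfold hyperbola_vertex; coords; ring.
    + intros t Z. apply (f_equal c3) in Z.
      assert (D : Derive (fun s => c3 (hyperbola_vertex a c d x0 s)) t = d * cosh t).
      { apply is_derive_unique. unfold hyperbola_vertex; coords. auto_derive; [exact I|ring]. }
      change (Derive (fun s => c3 (hyperbola_vertex a c d x0 s)) t = 0) in Z.
      rewrite D in Z. apply Rmult_integral in Z. pose proof (cosh_pos t). lra.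
  - intros s t Hst.
    destruct (Rtotal_order s t) as [H | [H | H]]; [|now elim Hst|].
    + now apply hyperbola_disjoint.
    + intros q [Q Q']. now apply (hyperbola_disjoint a c d k x0 t s) with q.
Qed.

(** * Choice of the parameters for a symmetric pair *)

Lemma symmetric_foliation_through (lam k e : R) :
  0 < lam -> k <> 0 -> Rabs k * sinh lam < e * cosh lam ->
  foliation_through (vec (k * cosh lam) (- e) (- (k * sinh lam)))
                    (vec (cosh lam) 0 (- sinh lam))
                    (vec (k * cosh lam) e (k * sinh lam))
                    (vec (cosh lam) 0 (sinh lam)).
Proof.
  intros Hl Hk He.
  pose proof (sinh_pos lam Hl) as Sl. pose proof (cosh_pos lam) as Cl.
  assert (Hk' : 0 < Rabs k) by now apply Rabs_pos_lt.
  set (K := Rabs k * sinh lam) in *.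
  assert (HK : 0 < K) by (unfold K; nra).
  set (g := e - K / cosh lam).
  assert (Hg : 0 < g).
  { unfold g. apply Rmult_lt_reg_r with (cosh lam); [exact Cl|].
    replace ((e - K / cosh lam) * cosh lam) with (e * cosh lam - K) by (field; lra). lra. }
  (* This [s] gives [Rabs d * s <= g]: the linear term of the second coordinate uses up at most the
     slack [g]. *)
  destruct (linear_le_sinh_eventually lam K g Hl HK Hg) as [s [Hs Hsg]].
  pose proof (sinh_pos s ltac:(lra)) as Ss. pose proof (cosh_pos s) as Cs.
  assert (Hsl : sinh lam * cosh s < cosh lam * sinh s).
  { pose proof (sinh_pos (s + - lam) ltac:(lra)) as Q.
    rewrite sinh_plus, sinh_opp, cosh_opp in Q. lra. }
  (* At parameters [- s] and [s], [d] fits the third coordinates of the vertices, [c] the slopes of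
     the directors (c tanh s = tanh lam), and [a] the second coordinates. *)
  set (d := k * sinh lam / sinh s).
  set (c := sinh lam * cosh s / (cosh lam * sinh s)).
  set (a := (e - Rabs d * s) / sinh s).
  assert (Ed : Rabs d * sinh s = K).
  { unfold d, K. rewrite Rabs_div, Rabs_mult by lra.
    rewrite (Rabs_pos_eq (sinh s)), (Rabs_pos_eq (sinh lam)) by lra. field; lra. }
  assert (Hc : 0 < c) by (unfold c; apply Rdiv_lt_0_compat; nra).
  assert (Hc1 : c < 1).
  { apply Rmult_lt_reg_r with (cosh lam * sinh s); [nra|].
    unfold c. field_simplify; lra. }
  assert (Eas : a * sinh s = e - Rabs d * s) by (unfold a; field; lra).
  assert (Hds : Rabs d * s <= g).
  { apply Rmult_le_reg_r with (sinh s); [exact Ss|].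
    replace (Rabs d * s * sinh s) with (K * s) by (rewrite <- Ed; ring). exact Hsg. }
  assert (Had : Rabs d <= a * cosh lam).
  { apply Rmult_le_reg_r with (sinh s); [exact Ss|]. rewrite Ed.
    replace (a * cosh lam * sinh s) with ((e - Rabs d * s) * cosh lam)
      by (rewrite <- Eas; ring).
    assert (K / cosh lam <= e - Rabs d * s) by (unfold g in Hds; lra).
    replace K with (K / cosh lam * cosh lam) at 1 by (field; lra).
    apply Rmult_le_compat_r; lra. }
  assert (Ha : 0 <= a).
  { pose proof (Rabs_pos d). nra. }
  assert (Hcl : sinh lam <= c * cosh lam).
  { replace (c * cosh lam) with (sinh lam * (cosh s / sinh s)) by (unfold c; field; lra).
    assert (1 <= cosh s / sinh s).
    { apply Rmult_le_reg_r with (sinh s); [exact Ss|].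
      replace (cosh s / sinh s * sinh s) with (cosh s) by (field; lra).
      pose proof (cosh_sqr s). nra. }
    nra. }
  exists (hyperbola_vertex a c d (k * cosh lam - c * d * cosh s)),
         (hyperbola_director c (cosh lam / cosh s)).
  split; [|split; [exists (- s)|exists s]].
  - apply hyperbola_foliation; auto.
    + unfold d. apply Rmult_integral_contrapositive_currified;
        [|now apply Rinv_neq_0_compat, Rgt_not_eq].
      apply Rmult_integral_contrapositive_currified; lra.
    + replace (d * d) with (Rabs d * Rabs d)
        by (unfold Rabs; destruct (Rcase_abs d); ring).
      (* Since coth s >= 1, [c] is at least tanh lam; with [Had] this yields the inequality between
         [d], [c] and [a]. *)
      assert (Q : 1 - c * c <= / (cosh lam * cosh lam)).
      { apply Rmult_le_reg_r with (cosh lam * cosh lam); [nra|].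
        rewrite Rinv_l by nra. pose proof (cosh_sqr lam).
        assert (sinh lam * sinh lam <= (c * cosh lam) * (c * cosh lam)) by nra. lra. }
      apply Rle_trans with (Rabs d * Rabs d * / (cosh lam * cosh lam)).
      * apply Rmult_le_compat_l; [pose proof (Rabs_pos d); nra|exact Q].
      * apply Rmult_le_reg_r with (cosh lam * cosh lam); [nra|].
        rewrite Rmult_assoc, Rinv_l by nra. pose proof (Rabs_pos d). nra.
    + now apply Rdiv_lt_0_compat.
  - unfold hyperbola_vertex, hyperbola_director. rewrite cosh_opp, sinh_opp.
    split; apply V_ext; coords.
    + ring.
    + lra.
    + unfold d; field; lra.
    + field; lra.
    + reflexivity.
    + unfold c; field; lra.
  - unfold hyperbola_vertex, hyperbola_director. split; apply V_ext; coords.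
    + ring.
    + lra.
    + unfold d; field; lra.
    + field; lra.
    + reflexivity.
    + unfold c; field; lra.
Qed.

(** * The gap forced by disjointness, and the conclusion *)

(** The boost by [- lam], sending (cosh t, 0, sinh t) to (cosh (t - lam), 0, sinh (t - lam)); rows
    written with [dot] make it linear by [is_linear_vec_dot]. *)
Definition boost (lam : R) (x : V) : V :=
  vec (dot (vec (cosh lam) 0 (sinh lam)) x) (dot (vec 0 1 0) x)
      (dot (vec (- sinh lam) 0 (- cosh lam)) x).

Lemma boost_isometry (lam : R) : linear_isometry_det1 (boost lam).
Proof.
  pose proof (cosh_sqr lam) as E.
  split; [apply is_linear_vec_dot|split].
  - intros [[x y] z] [[x' y'] z']. unfold boost; coords.
    transitivity ((x * x' - z * z') * (cosh lam * cosh lam - sinh lam * sinh lam) + y * y');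
      [ring|].
    rewrite E; ring.
  - unfold boost; coords.
    transitivity (cosh lam * cosh lam - sinh lam * sinh lam); [ring|]. rewrite E; ring.
Qed.

(* If alpha / 2 <= |k| tanh (l / 2), the displacement of the vertices splits
   into (0, alpha / 2, k tanh (l / 2)) and its boost by l, both in the stems. *)
Lemma disjoint_vertex_gap (A : V -> V) (c p0 u0 p1 u1 : V) (l k alpha : R) :
  linear_isometry_det1 A -> 0 < alpha -> 0 < l ->
  A u0 = vec 1 0 0 -> A u1 = vec (cosh l) 0 (sinh l) ->
  plus (A p0) c = vertex_curve l k alpha 0 0 ->
  plus (A p1) c = vertex_curve l k alpha 0 1 ->
  disjoint (crooked_plane p0 u0) (crooked_plane p1 u1) ->
  Rabs k * sinh (l / 2) < alpha / 2 * cosh (l / 2).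
Proof.
  intros H Ha Hl U0 U1 P0 P1 Dj.
  destruct (Rlt_le_dec (Rabs k * sinh (l / 2)) (alpha / 2 * cosh (l / 2)))
    as [L | L]; [exact L|exfalso].
  set (sh := sinh (l / 2)) in *. set (ch := cosh (l / 2)) in *.
  pose proof (cosh_sqr (l / 2) : ch * ch = 1 + sh * sh) as E.
  pose proof (cosh_pos (l / 2) : 0 < ch) as Hch.
  assert (Cl : cosh l = 1 + 2 * (sh * sh)).
  { replace l with (l / 2 + l / 2) by field. rewrite cosh_plus. fold sh ch. lra. }
  assert (Sl : sinh l = 2 * (sh * ch)).
  { replace l with (l / 2 + l / 2) by field. rewrite sinh_plus. fold sh ch. lra. }
  set (t := sh / ch). assert (Et : t * ch = sh) by (unfold t; field; lra).
  assert (Q : alpha / 2 * (alpha / 2) <= k * t * (k * t)).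
  { assert (Q : (alpha / 2 * ch) * (alpha / 2 * ch) <= (k * sh) * (k * sh)).
    { replace ((k * sh) * (k * sh)) with ((Rabs k * sh) * (Rabs k * sh))
        by (unfold Rabs; destruct (Rcase_abs k); ring).
      apply Rmult_le_compat; nra. }
    rewrite <- Et in Q. apply Rmult_le_reg_r with (ch * ch); [nra|]. lra. }
  (* The common point: in normal coordinates it is the first vertex (k, 0, 0) plus (0, alpha / 2, k
     tanh (l / 2)). *)
  set (q := isometry_inverse A (minus (vec k (alpha / 2) (k * t)) c)).
  assert (Aq : A q = minus (vec k (alpha / 2) (k * t)) c) by now apply isometry_inverse_r.
  pose proof H as [Lin [I _]].
  assert (Ec : forall p w : V, plus (A p) c = w ->
    A (minus q p) = minus (vec k (alpha / 2) (k * t)) w).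
  { intros p w <-. rewrite (linear_minus A _ _ Lin), Aq.
    apply V_ext; coords; unfold minus, plus, opp; cbn; ring. }
  apply Ec in P0; apply Ec in P1.
  unfold vertex_curve in P0, P1.
  replace (l * (0 + 0)) with 0 in P0 by ring. rewrite cosh_0, sinh_0 in P0.
  replace (l * (1 + 0)) with l in P1 by ring. rewrite Cl, Sl in P1, U1.
  apply (Dj q); split; left; split; rewrite <- I.
  - rewrite P0, U0. coords; unfold minus, plus, opp; cbn. ring.
  - rewrite P0. coords; unfold minus, plus, opp; cbn. lra.
  - rewrite P1, U1. coords; unfold minus, plus, opp; cbn.
    transitivity (4 * k * (sh * sh) * (ch * ch) - 2 * k * (sh * sh)
      - 4 * k * (sh * sh) * (sh * sh) - 2 * k * sh * (t * ch)); [ring|].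
    rewrite Et, E. ring.
  - rewrite P1. coords; unfold minus, plus, opp; cbn.
    apply Rle_trans with (alpha / 2 * (alpha / 2) - k * t * (k * t)); [|lra].
    apply Req_le.
    transitivity (alpha / 2 * (alpha / 2) - k * t * (k * t)
      + 4 * k * k * (sh * sh) * (sh * sh) + 4 * k * k * sh * (t * ch)
      - 4 * k * k * (sh * sh) * (ch * ch)); [field|].
    rewrite Et, E. ring.
Qed.

Theorem theorem7p3 (p0 p1 : E) (u0 u1 : V)
  (Hcal : calibrated_pair p0 u0 p1 u1)
  (Hdisj : disjoint (crooked_plane p0 u0) (crooked_plane p1 u1)) :
  exists (p : R -> E) (u : R -> V),
    crooked_foliation p u /\
    (exists s : R, same_set (crooked_plane (p s) (u s)) (crooked_plane p0 u0)) /\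
    (exists t : R, same_set (crooked_plane (p t) (u t)) (crooked_plane p1 u1)).
Proof.
  destruct Hcal as [_ [_ [_ [_ [A [c [l [k [alpha [H [Hl [Hk [Ha [U0 [U1 [P0 P1]]]]]]]]]]]]]]]].
  pose proof (disjoint_vertex_gap A c p0 u0 p1 u1 l k alpha H Ha Hl U0 U1 P0 P1 Hdisj) as G.
  assert (F : foliation_through p0 u0 p1 u1).
  { apply (foliation_through_pullback A c); [exact H|]. rewrite P0, P1, U0, U1.
    (* Boosting by [- l / 2] and lowering by [alpha / 2] puts the pairs in symmetric position at
       heights [- (alpha / 2)] and [alpha / 2]. *)
    apply (foliation_through_pullback (boost (l / 2)) (vec 0 (- (alpha / 2)) 0));
      [apply boost_isometry|].
    unfold vertex_curve.
    replace (l * (0 + 0)) with 0 by ring. replace (l * (1 + 0)) with l by ring.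
    rewrite cosh_0, sinh_0.
    pose proof (symmetric_foliation_through (l / 2) k (alpha / 2) ltac:(lra) Hk G) as F.
    pose proof (cosh_sqr (l / 2)) as E.
    assert (Cl : cosh l = 1 + 2 * (sinh (l / 2) * sinh (l / 2))).
    { replace l with (l / 2 + l / 2) at 1 by field. rewrite cosh_plus. lra. }
    assert (Sl : sinh l = 2 * (sinh (l / 2) * cosh (l / 2))).
    { replace l with (l / 2 + l / 2) at 1 by field. rewrite sinh_plus. lra. }
    assert (C3 : cosh (l / 2) * cosh l - sinh (l / 2) * sinh l = cosh (l / 2)).
    { rewrite Cl, Sl. transitivity (cosh (l / 2) * 1); ring. }
    assert (S3 : cosh (l / 2) * sinh l - sinh (l / 2) * cosh l = sinh (l / 2)).
    { rewrite Cl, Sl. transitivity (2 * sinh (l / 2) * (cosh (l / 2) * cosh (l / 2))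
        - sinh (l / 2) * (1 + 2 * (sinh (l / 2) * sinh (l / 2)))); [ring|].
      rewrite E; ring. }
    clear Cl Sl.
    unfold boost.
    match type of F with foliation_through ?a ?b ?d ?e =>
      match goal with |- foliation_through ?a' ?b' ?d' ?e' =>
        replace a' with a; [replace b' with b; [replace d' with d;
          [replace e' with e; [exact F|]|]|]|] end end;
    apply V_ext; coords; unfold plus; cbn; try ring; try lra.
    - transitivity (k * (cosh (l / 2) * cosh l - sinh (l / 2) * sinh l));
        [rewrite C3; ring|ring].
    - transitivity (k * (cosh (l / 2) * sinh l - sinh (l / 2) * cosh l));
        [rewrite S3; ring|ring]. }
  destruct F as [p [u [F [[s [Ps Us]] [t [Pt Ut]]]]]].
  exists p, u. split; [exact F|split; [exists s; rewrite Ps, Us|exists t; rewrite Pt, Ut]];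
    intro q; reflexivity.
Qed.
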